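(* Suppose that: (A) each $f_i$ is convex, $L_i$-smooth for some $L_i>0$, and bounded from below, $h_i\equiv 0$ for all $i\in\mathcal V$, and the problem $\min_{x\in\mathbb{R}^d}\sum_{i\in\mathcal V}f_i(x)$ has a non-empty and bounded optimal solution set; (B) each $f_i$ is $\mu_i$-strongly convex for some $\mu_i>0$; (C) (partial asynchrony) there exist non-negative integers $B$ and $D$ such that for every $i\in\mathcal V$ and every $k\in\mathbb{N}_0$ at least one element of $\{k,\dots,k+B\}$ belongs to $\mathcal K_i$, and $k-D\le s_{ij}^k\le k$ for all $i\in\mathcal V$, $j\in\mathcal N_i$ and $k\in\mathcal K_i$; (D) $\displaystyle\alpha\in\Bigl(0,\frac{2}{\max_{i\in\mathcal V}L_i}\Bigr)$. Let $\{\mathbf{x}^k\}$ be generated by the asynchronous DGD-ATC from any $\mathbf{x}^0\in\mathbb{R}^{nd}$, let $\mathbf{x}^\star$ be the fixed point of the synchronous DGD-ATC, and let $\hat\rho=\sqrt{1-\alpha\min_{i\in\mathcal V}(\mu_i(2-\alpha L_i))}$. If $k\ge k^m$ for some $m\in\mathbb{N}_0$, then $$\|\mathbf{x}^k-\mathbf{x}^\star\|_\infty^b\le\hat\rho^m\|\mathbf{x}^0-\mathbf{x}^\star\|_\infty^b,$$ where the sequence $\{k^m\}_{m\in\mathbb{N}_0}$, determined by the realized update times and delays, is defined in the context.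
   Context: $\mathcal G=(\mathcal V,\mathcal E)$ is an undirected connected graph with vertex set $\mathcal V=\{1,\dots,n\}$; $\mathcal E$ contains no self-loops; $\mathcal N_i=\{j:\{i,j\}\in\mathcal E\}$ and $\bar{\mathcal N}_i=\mathcal N_i\cup\{i\}$. For each $i\in\mathcal V$, $f_i:\mathbb{R}^d\to\mathbb{R}$ (the general problem has an additional term $h_i$ in each local cost, here zero). A differentiable function $f$ is $L$-smooth if $\|\nabla f(y)-\nabla f(x)\|\le L\|y-x\|$ for all $x,y$, and $\mu$-strongly convex if $\langle\nabla f(y)-\nabla f(x),y-x\rangle\ge\mu\|y-x\|^2$ for all $x,y$. For $\mathbf{x}=(x_1^T,\dots,x_n^T)^T\in\mathbb{R}^{nd}$ with $x_i\in\mathbb{R}^d$, put $f(\mathbf{x})=\sum_{i}f_i(x_i)$ and $\|\mathbf{x}\|_\infty^b=\max_{i\in\mathcal V}\|x_i\|$ (Euclidean norm on each block). $W=(w_{ij})\in\mathbb{R}^{n\times n}$ is a positive definite averaging matrix associated with $\mathcal G$: it is symmetric positive definite and doubly stochastic (non-negative, rows and columns sum to 1), and $w_{ij}>0$ if $\{i,j\}\in\mathcal E$ or $i=j$, $w_{ij}=0$ otherwise. $\mathbf{W}=W\otimes I_d$. Synchronous DGD-ATC with step-size $\alpha>0$: $\mathbf{x}^{k+1}=\mathbf{W}(\mathbf{x}^k-\alpha\nabla f(\mathbf{x}^k))$; a fixed point is $\mathbf{x}^\star$ with $\mathbf{x}^\star=\mathbf{W}(\mathbf{x}^\star-\alpha\nabla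 f(\mathbf{x}^\star))$. Asynchronous DGD-ATC with step-size $\alpha$: for each $i\in\mathcal V$ and $k\in\mathbb{N}_0=\{0,1,2,\dots\}$, $$x_i^{k+1}=\begin{cases}\sum_{j\in\bar{\mathcal N}_i}w_{ij}\bigl(x_j^{s_{ij}^k}-\alpha\nabla f_j(x_j^{s_{ij}^k})\bigr),&k\in\mathcal K_i,\\ x_i^k,&\text{otherwise},\end{cases}$$ where $\mathcal K_i\subseteq\mathbb{N}_0$ is the set of iterations at which node $i$ updates, the integer $s_{ij}^k\in[0,k]$, $j\in\mathcal N_i$, is the iteration index of the most recent $y_j=x_j-\alpha\nabla f_j(x_j)$ that node $i$ has received from $j$, and $s_{ii}^k=k$. Definition of $\{k^m\}$: let $t_i^k=\max\{\ell:\ell\le k,\ \ell\in\mathcal K_i\}$ (the most recent update of node $i$), $\tau^k=k-\min_{i\in\mathcal V}\min_{j\in\bar{\mathcal N}_i}s_{ij}^{t_i^k}$, $k^0=0$ and $$k^{m+1}=\min\{k:\ t-\tau^t\ge k^m\ \ \forall t\ge k\}+1,\qquad m\in\mathbb{N}_0.$$ Convention: if some node has not updated by iteration $t$ (so $t_i^t$, hence $\tau^t$, is undefined), the condition $t-\tau^t\ge k^m$ is regarded as false. *)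

(* Defs.v *)
From mathcomp Require Export all_boot all_order all_algebra.
From mathcomp Require Export all_classical all_reals all_analysis.
From mathcomp Require Export mxtens.

Set Implicit Arguments.
Unset Strict Implicit.
Unset Printing Implicit Defensive.

Export Order.TTheory GRing.Theory Num.Theory numFieldNormedType.Exports.

Global Open Scope classical_set_scope.
Global Open Scope ring_scope.

(* The norm that the library puts on matrices is the sup norm, so the Euclidean
   structure of R^p is introduced separately.  Topology, differentiability and
   boundedness do not depend on which of the two norms is used. *)
Definition dot (R : realType) (p : nat) (u v : 'cV[R]_p) : R :=
  (u^T *m v) 0 0.

Definition enorm (R : realType) (p : nat) (u : 'cV[R]_p) : R :=
  Num.sqrt (dot u u).

Definition grad (R : realType) (p : nat) (f : 'cV[R]_p -> R) (x : 'cV[R]_p)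
    : 'cV[R]_p :=
  \col_j 'D_(delta_mx j 0) f x.

Definition smooth (R : realType) (p : nat) (L : R) (f : 'cV[R]_p -> R) : Prop :=
  (forall x, differentiable f x) /\
  (forall x y, enorm (grad f y - grad f x) <= L * enorm (y - x)).

Definition strongly_convex (R : realType) (p : nat) (mu : R)
    (f : 'cV[R]_p -> R) : Prop :=
  (forall x, differentiable f x) /\
  (forall x y, dot (grad f y - grad f x) (y - x) >= mu * enorm (y - x) ^+ 2).

Definition minimizers (R : realType) (p : nat) (F : 'cV[R]_p -> R)
    : set 'cV[R]_p :=
  [set x | forall y, F x <= F y].

(* Extrema of a nonempty finite family; [x ord0] as starting value makes them
   genuine maxima and minima whatever the signs. *)
Definition fmax (R : realType) (n : nat) (x : 'I_n.+1 -> R) : R :=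
  \big[Num.max/x ord0]_i x i.

Definition fmin (R : realType) (n : nat) (x : 'I_n.+1 -> R) : R :=
  \big[Num.min/x ord0]_i x i.

(* The node set {1, ..., n} of the mathematics is ['I_n.+1] here, so that it is
   nonempty; [e i j] means that {i, j} is an edge. *)
Definition connected_graph (n : nat) (e : rel 'I_n.+1) : Prop :=
  [/\ symmetric e, irreflexive e & forall i j, connect e i j].

Definition nbr (n : nat) (e : rel 'I_n.+1) (i : 'I_n.+1) : {set 'I_n.+1} :=
  [set j | e i j]%SET.

Definition cnbr (n : nat) (e : rel 'I_n.+1) (i : 'I_n.+1) : {set 'I_n.+1} :=
  (i |: nbr e i)%SET.

Definition posdef (R : realType) (p : nat) (W : 'M[R]_p) : Prop :=
  W^T = W /\ forall v : 'cV[R]_p, v != 0 -> 0 < dot v (W *m v).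

Definition doubly_stochastic (R : realType) (p : nat) (W : 'M[R]_p) : Prop :=
  [/\ forall i j, 0 <= W i j,
      forall i, \sum_j W i j = 1
    & forall j, \sum_i W i j = 1].

Definition posdef_averaging (R : realType) (n : nat) (e : rel 'I_n.+1)
    (W : 'M[R]_n.+1) : Prop :=
  [/\ posdef W, doubly_stochastic W
    & forall i j, (e i j || (i == j) -> 0 < W i j) /\
                  (~~ (e i j || (i == j)) -> W i j = 0)].

(* R^{nd} is ['cV[R]_(n.+1 * d)]; [mxtens_index (i, j)] is i * d + j, so
   [block x i] is the i-th subvector of length d. *)
Definition block (R : realType) (n d : nat) (x : 'cV[R]_(n.+1 * d))
    (i : 'I_n.+1) : 'cV[R]_d :=
  \col_j x (mxtens_index (i, j)) 0.

Definition bnorm (R : realType) (n d : nat) (x : 'cV[R]_(n.+1 * d)) : R :=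
  fmax (fun i => enorm (block x i)).

Definition separable_sum (R : realType) (n d : nat)
    (f : 'I_n.+1 -> 'cV[R]_d -> R) (x : 'cV[R]_(n.+1 * d)) : R :=
  \sum_i f i (block x i).

Definition sync_fixed_point (R : realType) (n d : nat) (W : 'M[R]_n.+1)
    (f : 'I_n.+1 -> 'cV[R]_d -> R) (alpha : R) (x : 'cV[R]_(n.+1 * d)) : Prop :=
  x = (W *t (1%:M : 'M[R]_d)) *m (x - alpha *: grad (separable_sum f) x).

(* [K i] is the set of update times of node i and [s i j k] the iteration index
   s_ij^k; the latter is constrained only when node i updates at time k. *)
Definition async_iterates (R : realType) (n d : nat) (e : rel 'I_n.+1)
    (W : 'M[R]_n.+1) (f : 'I_n.+1 -> 'cV[R]_d -> R) (alpha : R)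
    (K : 'I_n.+1 -> set nat) (s : 'I_n.+1 -> 'I_n.+1 -> nat -> nat)
    (x : nat -> 'cV[R]_(n.+1 * d)) : Prop :=
  forall i k,
    (K i k ->
      [/\ forall j, j \in nbr e i -> (s i j k <= k)%N,
          s i i k = k
        & block (x k.+1) i =
          \sum_(j in cnbr e i)
            W i j *: (block (x (s i j k)) j
                      - alpha *: grad (f j) (block (x (s i j k)) j))]) /\
    (~ K i k -> block (x k.+1) i = block (x k) i).

Definition partially_asynchronous (n : nat) (e : rel 'I_n.+1)
    (K : 'I_n.+1 -> set nat) (s : 'I_n.+1 -> 'I_n.+1 -> nat -> nat)
    (B D : nat) : Prop :=
  (forall i k, exists2 l, (k <= l <= k + B)%N & K i l) /\
  (forall i j k, j \in nbr e i -> K i k -> (k - D <= s i j k <= k)%N).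

(* The time t_i^k; meaningful only if node i has updated by time k. *)
Definition last_update (Ki : set nat) (k : nat) : nat :=
  (\max_(l < k.+1 | (l : nat) \in Ki) l)%N.

(* The starting value k of the minima is neutral, since s_ij^t <= t <= k at the
   update time t = t_i^k. *)
Definition tau (n : nat) (e : rel 'I_n.+1) (K : 'I_n.+1 -> set nat)
    (s : 'I_n.+1 -> 'I_n.+1 -> nat -> nat) (k : nat) : nat :=
  (k - \big[minn/k]_i \big[minn/k]_(j in cnbr e i)
         s i j (last_update (K i) k))%N.

(* "t - tau^t >= c", false as long as tau^t is undefined; the subtraction does
   not truncate because tau^t <= t. *)
Definition fresh (n : nat) (e : rel 'I_n.+1) (K : 'I_n.+1 -> set nat)
    (s : 'I_n.+1 -> 'I_n.+1 -> nat -> nat) (c t : nat) : Prop :=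
  (forall i, exists2 l, (l <= t)%N & K i l) /\ (c <= t - tau e K s t)%N.

(* Junk value 0 for the empty set. *)
Definition nat_min (A : set nat) : nat := xget 0%N (A `&` lbound A).

(* [kseq e K s m] is k^m.  Under bounded delays and update gaps the set below is
   nonempty, so the junk value of [nat_min] is not reached. *)
Fixpoint kseq (n : nat) (e : rel 'I_n.+1) (K : 'I_n.+1 -> set nat)
    (s : 'I_n.+1 -> 'I_n.+1 -> nat -> nat) (m : nat) : nat :=
  if m is m'.+1 then
    (nat_min [set k | forall t, (k <= t)%N -> fresh e K s (kseq e K s m') t]).+1
  else 0%N.

Definition rho_hat (R : realType) (n : nat) (alpha : R) (L mu : 'I_n.+1 -> R)
    : R :=
  Num.sqrt (1 - alpha * fmin (fun i => mu i * (2 - alpha * L i))).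

(* Main.v *)
(* Strong monotonicity makes each f_i convex, so with smoothness the gradient
   is cocoercive, and the gradient step y - alpha grad f_i(y) contracts the
   Euclidean distance by rho_hat.  Averaging with the nonnegative rows of W
   preserves this bound in the block-max norm.  Each block at time k + 1 is the
   output of the last update of its node, whose inputs are all dated at least
   k^m as soon as k + 1 >= k^(m+1); hence one factor rho_hat per m. *)
Require Import Defs.
From mathcomp Require Import ring lra zify.

Set Implicit Arguments.
Unset Strict Implicit.
Unset Printing Implicit Defensive.

(** * Euclidean inner product and norm *)

Lemma dotE (R : realType) (p : nat) (u v : 'cV[R]_p) :
  dot u v = \sum_i u i 0 * v i 0.
Proof. by rewrite /dot mxE; apply: eq_bigr => i _; rewrite mxE. Qed.

Lemma dotC (R : realType) (p : nat) (u v : 'cV[R]_p) : dot u v = dot v u.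
Proof. by rewrite !dotE; apply: eq_bigr => i _; rewrite mulrC. Qed.

Lemma dotDr (R : realType) (p : nat) (u v w : 'cV[R]_p) :
  dot u (v + w) = dot u v + dot u w.
Proof. by rewrite /dot mulmxDr mxE. Qed.

Lemma dotZr (R : realType) (p : nat) (a : R) (u v : 'cV[R]_p) :
  dot u (a *: v) = a * dot u v.
Proof. by rewrite /dot -scalemxAr mxE. Qed.

Lemma dotNr (R : realType) (p : nat) (u v : 'cV[R]_p) :
  dot u (- v) = - dot u v.
Proof. by rewrite -scaleN1r dotZr mulN1r. Qed.

Lemma dotDl (R : realType) (p : nat) (u v w : 'cV[R]_p) :
  dot (u + v) w = dot u w + dot v w.
Proof. by rewrite ![dot _ w]dotC dotDr. Qed.

Lemma dotZl (R : realType) (p : nat) (a : R) (u v : 'cV[R]_p) :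
  dot (a *: u) v = a * dot u v.
Proof. by rewrite ![dot _ v]dotC dotZr. Qed.

Lemma dotNl (R : realType) (p : nat) (u v : 'cV[R]_p) :
  dot (- u) v = - dot u v.
Proof. by rewrite ![dot _ v]dotC dotNr. Qed.

Lemma dot_ge0 (R : realType) (p : nat) (u : 'cV[R]_p) : 0 <= dot u u.
Proof. by rewrite dotE sumr_ge0// => i _; rewrite -expr2 sqr_ge0. Qed.

Lemma enorm_ge0 (R : realType) (p : nat) (u : 'cV[R]_p) : 0 <= enorm u.
Proof. exact: sqrtr_ge0. Qed.

Lemma enorm_sqr (R : realType) (p : nat) (u : 'cV[R]_p) :
  enorm u ^+ 2 = dot u u.
Proof. by rewrite sqr_sqrtr ?dot_ge0. Qed.

Lemma enorm0 (R : realType) (p : nat) : enorm (0 : 'cV[R]_p) = 0.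
Proof. by rewrite /enorm -(scale0r 0) dotZl mul0r sqrtr0. Qed.

(** Cauchy-Schwarz, by expanding the squared norm of [dot u u *: v - dot u v *: u]. The cases
    [enorm u = 0] and [dot u v <= 0] come first, so that a positive factor can be cancelled and
    squares compared. *)
Lemma dot_le_enorm (R : realType) (p : nat) (u v : 'cV[R]_p) :
  dot u v <= enorm u * enorm v.
Proof.
have [u0|u0] := eqVneq (enorm u) 0.
  have ui i : u i 0 = 0.
    apply/eqP; rewrite -sqrf_eq0 expr2; apply/eqP; move: i isT.
    apply: (@psumr_eq0P _ _ xpredT) => [i _|]; first by rewrite -expr2 sqr_ge0.
    by rewrite -dotE -enorm_sqr u0 expr0n.
  by rewrite u0 mul0r dotE big1// => i _; rewrite ui mul0r.
have up : 0 < enorm u by rewrite lt_def u0 enorm_ge0.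
have [v0|v0] := leP (dot u v) 0.
  by rewrite (le_trans v0)// mulr_ge0 ?enorm_ge0.
have := dot_ge0 (dot u u *: v - dot u v *: u).
rewrite !(dotDl, dotDr, dotNl, dotNr, dotZl, dotZr) (dotC v u) -!enorm_sqr.
set a := enorm u in up *; set b := enorm v; set c := dot u v in v0 *.
move=> H; have : 0 <= a ^+ 2 * ((a * b) ^+ 2 - c ^+ 2) by lra.
by rewrite pmulr_rge0 ?exprn_gt0// subr_ge0 ler_sqr//
   ?nnegrE ?mulr_ge0 ?enorm_ge0 ?ltW.
Qed.

Lemma enormD_le (R : realType) (p : nat) (u v : 'cV[R]_p) :
  enorm (u + v) <= enorm u + enorm v.
Proof.
rewrite -ler_sqr ?nnegrE ?addr_ge0 ?enorm_ge0//.
rewrite enorm_sqr dotDl !dotDr (dotC v u) sqrrD -!enorm_sqr.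
by have := dot_le_enorm u v; lra.
Qed.

Lemma enormZ (R : realType) (p : nat) (a : R) (u : 'cV[R]_p) :
  0 <= a -> enorm (a *: u) = a * enorm u.
Proof.
move=> a0; rewrite /enorm dotZl dotZr mulrA -expr2.
by rewrite sqrtrM ?sqr_ge0// sqrtr_sqr ger0_norm.
Qed.

Lemma enorm_sum_le (R : realType) (p n : nat) (w : 'I_n -> R)
    (u : 'I_n -> 'cV[R]_p) :
  (forall j, 0 <= w j) ->
  enorm (\sum_j w j *: u j) <= \sum_j w j * enorm (u j).
Proof.
move=> w0; elim/big_rec2: _ => [|j a b _ ab]; first by rewrite enorm0.
by rewrite (le_trans (enormD_le _ _))// enormZ// lerD2l.
Qed.

(** * Gradients, mean values and contraction of the gradient step *)

Lemma derive_dot_grad (R : realType) (p : nat) (f : 'cV[R]_p -> R)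
    (x v : 'cV[R]_p) :
  differentiable f x -> 'D_v f x = dot (grad f x) v.
Proof.
move=> df; rewrite deriveE// dotE {1}[v]matrix_sum_delta linear_sum.
by apply: eq_bigr => i _; rewrite big_ord1 linearZ/= mxE deriveE// mulrC.
Qed.

Lemma is_derive_line (R : realType) (p : nat) (f : 'cV[R]_p -> R)
    (x v : 'cV[R]_p) (t : R) :
  differentiable f (x + t *: v) ->
  is_derive t 1 (fun r : R => f (x + r *: v)) (dot (grad f (x + t *: v)) v).
Proof.
move=> df.
(* The difference quotient along the line is already that of [f] at [x + t *: v] in direction [v],
   which replaces a chain rule. *)
have E : (fun h : R => h^-1 *: (((fun r : R => f (x + r *: v)) \o shift t) (h *: 1)
            - f (x + t *: v))) =
         (fun h : R => h^-1 *: ((f \o shift (x + t *: v)) (h *: v)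
            - f (x + t *: v))).
  apply/funext => h /=; congr (_ *: (f _ - _)).
  by rewrite [h%:A]mulr1 scalerDl addrCA.
apply: DeriveDef.
  by rewrite /derivable E; exact: diff_derivable.
by rewrite /derive E -derive_dot_grad.
Qed.

(* The quadratic correction lets one mean value argument give both the
   first-order convexity bound (b = 0) and the descent lemma (b = L / 2). *)
Lemma line_mean_value (R : realType) (p : nat) (f : 'cV[R]_p -> R)
    (x v : 'cV[R]_p) (b : R) :
  (forall y, differentiable f y) ->
  exists2 t, 0 < t < 1 &
    f (x + v) - f x - b = dot (grad f (x + t *: v)) v - 2 * b * t.
Proof.
move=> df.
have dg (t : R) : is_derive t (1 : R) (fun r : R => f (x + r *: v) - b * (r * r))
    (dot (grad f (x + t *: v)) v - 2 * b * t).
  apply: is_deriveB; first exact: is_derive_line.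
  have -> : 2 * b * t = b *: (t *: 1 + t *: 1 : R).
    by rewrite /GRing.scale /=; ring.
  by apply: is_deriveZ; exact: is_deriveM.
have [|t t01 E] := @MVT R _ _ 0 1 ltr01 (fun t _ => dg t).
  apply: derivable_within_continuous => t _.
  exact: (@ex_derive _ _ _ _ _ _ _ (dg t)).
exists t; first by move: t01; rewrite in_itv.
apply: etrans (etrans E _); last by rewrite subr0 mulr1.
by rewrite scale1r scale0r addr0; ring.
Qed.

(** The Lipschitz bound at the intermediate point is exactly the derivative of the quadratic
    correction at [t], so the unknown [t] cancels. *)
Lemma descent_lemma (R : realType) (p : nat) (f : 'cV[R]_p -> R) (L : R)
    (x v : 'cV[R]_p) :
  smooth L f -> f (x + v) <= f x + dot (grad f x) v + L / 2 * dot v v.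
Proof.
move=> [df lip].
have [t /andP[t0 t1] E] := line_mean_value x v (L / 2 * dot v v) df.
have : dot (grad f (x + t *: v) - grad f x) v <= L * t * dot v v.
  rewrite (le_trans (dot_le_enorm _ _))//.
  apply: (@le_trans _ _ (L * enorm (t *: v) * enorm v)).
    rewrite ler_wpM2r ?enorm_ge0//.
    by have := lip x (x + t *: v); rewrite [x + _ - x]addrAC subrr add0r.
  by rewrite enormZ ?(ltW t0)// -enorm_sqr expr2 !mulrA.
by rewrite dotDl dotNl; lra.
Qed.

Lemma strongly_convex_first_order (R : realType) (p : nat)
    (f : 'cV[R]_p -> R) (mu : R) (x y : 'cV[R]_p) :
  0 <= mu -> strongly_convex mu f -> f x + dot (grad f x) (y - x) <= f y.
Proof.
move=> mu0 [df mon].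
have [t /andP[t0 t1]] := line_mean_value x (y - x) 0 df.
rewrite subr0 mulr0 mul0r subr0 subrKC => E.
(* Monotonicity between [x] and the intermediate point carries a factor [t], which is cancelled
   because [t > 0]. *)
have := mon x (x + t *: (y - x)).
rewrite [x + _ - x]addrAC subrr add0r dotZr dotDl dotNl => H.
have : 0 <= t * (dot (grad f (x + t *: (y - x))) (y - x)
                 - dot (grad f x) (y - x)).
  by rewrite (le_trans _ H)// mulr_ge0// sqr_ge0.
by rewrite pmulr_rge0//; lra.
Qed.

(* Baillon-Haddad: compare the two first-order bounds at
   z = y - (grad f y - grad f x) / L. *)
Lemma grad_cocoercive (R : realType) (p : nat) (f : 'cV[R]_p -> R) (L mu : R)
    (x y : 'cV[R]_p) :
  0 < L -> smooth L f -> 0 <= mu -> strongly_convex mu f ->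
  dot (grad f y - grad f x) (grad f y - grad f x)
    <= L * dot (grad f y - grad f x) (y - x).
Proof.
move=> L0 sm mu0 sc.
have half (a b : 'cV[R]_p) : f a + dot (grad f a) (b - a)
    + L^-1 / 2 * dot (grad f b - grad f a) (grad f b - grad f a) <= f b.
  set g := grad f b - grad f a.
  have lo := strongly_convex_first_order a (b - L^-1 *: g) mu0 sc.
  have up := descent_lemma b (- (L^-1 *: g)) sm.
  have gE : dot g g = dot (grad f b) g - dot (grad f a) g.
    by rewrite /g dotDl dotNl.
  clearbody g; move: lo up; rewrite addrAC !(dotDr, dotNr, dotNl, dotZl, dotZr) gE.
  set d := dot (grad f b) g - _.
  have -> : L / 2 * - - (L^-1 * (L^-1 * d)) = L^-1 / 2 * d by field; lra.
  rewrite /d; lra.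
(* Adding the two instances eliminates the function values. *)
have := half x y; have := half y x.
rewrite -[grad f x - grad f y]opprB -[x - y]opprB.
rewrite !(dotNl, dotNr) opprK => h1 h2.
have : L^-1 * dot (grad f y - grad f x) (grad f y - grad f x)
    <= dot (grad f y - grad f x) (y - x).
  by rewrite [X in _ <= X]dotDl dotNl; lra.
by rewrite -ler_pdivrMl.
Qed.

(** With v the difference of the points and g that of the gradients, expand |v - alpha g|^2.
    Cocoercivity absorbs alpha^2 |g|^2 into the cross term, leaving -alpha (2 - alpha L) <g, v>;
    since 2 - alpha L >= 0, strong monotonicity then bounds <g, v> below by mu |v|^2. *)
Lemma gradient_step_contraction (R : realType) (p : nat) (f : 'cV[R]_p -> R)
    (L mu alpha c : R) (x y : 'cV[R]_p) :
  0 < L -> smooth L f -> 0 <= mu -> strongly_convex mu f ->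
  0 <= alpha -> alpha * L <= 2 -> c <= mu * (2 - alpha * L) ->
  enorm ((y - alpha *: grad f y) - (x - alpha *: grad f x))
    <= Num.sqrt (1 - alpha * c) * enorm (y - x).
Proof.
move=> L0 sm mu0 sc a0 aL cle.
(* The root of a product splits as soon as one factor is non-negative; here that factor is
   [dot (y - x) (y - x)], so the sign of [1 - alpha * c] is left open. *)
rewrite /enorm mulrC -sqrtrM ?dot_ge0// ler_wsqrtr//.
have -> : y - alpha *: grad f y - (x - alpha *: grad f x)
    = (y - x) - alpha *: (grad f y - grad f x).
  by rewrite scalerBr !opprB [alpha *: grad f x - x]addrC addrACA
    [- (alpha *: _) + _]addrC.
have coc := grad_cocoercive x y L0 sm mu0 sc.
have [_ /(_ x y)] := sc; rewrite enorm_sqr => mon.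
move: (grad f y - grad f x) (y - x) coc mon => g v coc mon.
rewrite !(dotDl, dotDr, dotNl, dotNr, dotZl, dotZr) (dotC v g).
have H1 : alpha * (alpha * dot g g) <= alpha * (alpha * (L * dot g v)).
  by rewrite !ler_wpM2l.
have H2 : alpha * ((2 - alpha * L) * (mu * dot v v))
    <= alpha * ((2 - alpha * L) * dot g v).
  by rewrite ler_wpM2l// ler_wpM2l//; lra.
have H3 : alpha * (c * dot v v) <= alpha * (mu * (2 - alpha * L) * dot v v).
  by rewrite ler_wpM2l// ler_wpM2r ?dot_ge0.
lra.
Qed.

(** * Blocks of stacked vectors and the blockwise fixed-point equation *)

Lemma blockB (R : realType) (n d : nat) (x y : 'cV[R]_(n.+1 * d))
    (i : 'I_n.+1) : block (x - y) i = block x i - block y i.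
Proof. by apply/colP => j; rewrite !mxE. Qed.

Lemma blockZ (R : realType) (n d : nat) (a : R) (x : 'cV[R]_(n.+1 * d))
    (i : 'I_n.+1) : block (a *: x) i = a *: block x i.
Proof. by apply/colP => j; rewrite !mxE. Qed.

Lemma blockD (R : realType) (n d : nat) (x y : 'cV[R]_(n.+1 * d))
    (i : 'I_n.+1) : block (x + y) i = block x i + block y i.
Proof. by apply/colP => j; rewrite !mxE. Qed.

Lemma block_tens_mul (R : realType) (n d : nat) (W : 'M[R]_n.+1)
    (z : 'cV[R]_(n.+1 * d)) (i : 'I_n.+1) :
  block ((W *t (1%:M : 'M[R]_d)) *m z) i = \sum_j W i j *: block z j.
Proof.
apply/colP => k; rewrite summxE !mxE.
(* Split the summation index into pairs (j, l); the identity factor of the Kronecker product then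
   keeps only l = k. *)
rewrite (reindex (@mxtens_index n.+1 d)) /=; last first.
  by exists (@mxtens_unindex n.+1 d) => u _;
    [exact: mxtens_indexK|exact: mxtens_unindexK].
transitivity (\sum_j \sum_l (W *t 1%:M) (mxtens_index (i, k))
    (mxtens_index (j, l)) * z (mxtens_index (j, l)) 0).
  by rewrite pair_bigA; apply: eq_bigr => -[].
apply: eq_bigr => j _; rewrite !mxE (bigD1 k)//= big1 ?addr0 => [|l lk].
  by rewrite tensmxE mxE eqxx mulr1.
by rewrite tensmxE mxE eq_sym (negPf lk) mulr0 mul0r.
Qed.

Lemma block_delta (R : realType) (n d : nat) (i j : 'I_n.+1) (k : 'I_d) :
  block (delta_mx (mxtens_index (i, k)) 0 : 'cV[R]_(n.+1 * d)) j
    = if j == i then delta_mx k 0 else 0.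
Proof.
apply/colP => l; rewrite !mxE (inj_eq (can_inj (@mxtens_indexK n.+1 d))).
by rewrite xpair_eqE; case: (j == i); rewrite mxE.
Qed.

Lemma is_derive_block (R : realType) (n d : nat) (g : 'cV[R]_d -> R)
    (x v : 'cV[R]_(n.+1 * d)) (i : 'I_n.+1) :
  differentiable g (block x i) ->
  is_derive x v (fun y => g (block y i)) (dot (grad g (block x i)) (block v i)).
Proof.
move=> dg.
have E : (fun h : R => h^-1 *: (((fun y => g (block y i)) \o shift x) (h *: v)
            - g (block x i))) =
         (fun h : R => h^-1 *: ((g \o shift (block x i)) (h *: block v i)
            - g (block x i))).
  by apply/funext => h /=; rewrite blockD blockZ.
apply: DeriveDef.
  by rewrite /derivable E; exact: diff_derivable.
by rewrite /derive E -derive_dot_grad.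
Qed.

(** A basis direction lying in block i has zero component in every other block, so only the i-th
    summand contributes to the derivative. *)
Lemma grad_separable_sum (R : realType) (n d : nat)
    (f : 'I_n.+1 -> 'cV[R]_d -> R) (x : 'cV[R]_(n.+1 * d)) (i : 'I_n.+1) :
  (forall j y, differentiable (f j) y) ->
  block (grad (separable_sum f) x) i = grad (f i) (block x i).
Proof.
move=> df; apply/colP => k; rewrite !mxE.
set v : 'cV[R]_(n.+1 * d) := delta_mx _ 0.
have -> : separable_sum f = \sum_j (fun y => f j (block y j)).
  by apply/funext => y; rewrite fct_sumE.
have D := is_derive_sum (fun j => is_derive_block v (df j (block x j))).
rewrite (@derive_val _ _ _ _ _ _ _ D) (bigD1 i)//= big1 => [|j ji].
  by rewrite addr0 block_delta eqxx -derive_dot_grad.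
by rewrite block_delta (negPf ji) -(scale0r (0 : 'cV[R]_d)) dotZr mul0r.
Qed.

Lemma sync_fixed_point_block (R : realType) (n d : nat) (W : 'M[R]_n.+1)
    (f : 'I_n.+1 -> 'cV[R]_d -> R) (alpha : R) (x : 'cV[R]_(n.+1 * d))
    (i : 'I_n.+1) :
  (forall j y, differentiable (f j) y) -> sync_fixed_point W f alpha x ->
  block x i
    = \sum_j W i j *: (block x j - alpha *: grad (f j) (block x j)).
Proof.
move=> df fx; rewrite {1}fx block_tens_mul; apply: eq_bigr => j _.
by rewrite blockB blockZ grad_separable_sum.
Qed.

(** * Finite extrema, last updates and the sequence k^m *)

Lemma fmax_ge (R : realType) (n : nat) (x : 'I_n.+1 -> R) (i : 'I_n.+1) :
  x i <= fmax x.
Proof. exact: le_bigmax. Qed.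

Lemma fmax_le (R : realType) (n : nat) (x : 'I_n.+1 -> R) (c : R) :
  (forall i, x i <= c) -> fmax x <= c.
Proof. by move=> xc; apply: bigmax_le. Qed.

Lemma fmin_le (R : realType) (n : nat) (x : 'I_n.+1 -> R) (i : 'I_n.+1) :
  fmin x <= x i.
Proof. exact: bigmin_le. Qed.

Lemma fmin_ge (R : realType) (n : nat) (x : 'I_n.+1 -> R) (c : R) :
  (forall i, c <= x i) -> c <= fmin x.
Proof. by move=> xc; apply: le_bigmin. Qed.

Lemma enorm_block_le (R : realType) (n d : nat) (x : 'cV[R]_(n.+1 * d))
    (i : 'I_n.+1) : enorm (block x i) <= bnorm x.
Proof. exact: (fmax_ge (fun j => enorm (block x j))). Qed.

Lemma leq_bigminn (I : finType) (P : pred I) (F : I -> nat) (c k : nat) :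
  (c <= \big[minn/k]_(i | P i) F i)%N <->
  ((c <= k)%N /\ forall i, P i -> (c <= F i)%N).
Proof.
split=> [|[ck cF]]; last first.
  by elim/big_ind: _ => // a b ca cb; rewrite leq_min ca.
rewrite -minEnat; split.
  by rewrite (leq_trans H)//; exact: (@bigmin_le_id _ nat).
by move=> i Pi; rewrite (leq_trans H)//; exact: (@bigmin_le_cond _ nat).
Qed.

Lemma last_updateP (A : set nat) (k l : nat) : (l <= k)%N -> A l ->
  [/\ A (last_update A k), (l <= last_update A k <= k)%N
    & forall j, (last_update A k < j <= k)%N -> ~ A j].
Proof.
move=> lk Al.
have ub j : (j <= k)%N -> A j -> (j <= last_update A k)%N.
  move=> jk Aj; rewrite -ltnS in jk.
  apply: (leq_bigmax_cond (Ordinal jk)).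
  by rewrite inE.
split.
- rewrite /last_update.
  have [|i Ai ->] := @eq_bigmax_cond _ (fun j : 'I_k.+1 => (j : nat) \in A)
    (fun j => j : nat); last by move: Ai; rewrite !inE.
  (* The update at [l] makes the index set non-empty, so the maximum is attained and is not the
     default 0. *)
  rewrite -ltnS in lk; apply/card_gt0P; exists (Ordinal lk).
  by rewrite !inE.
- rewrite ub//=; apply/bigmax_leqP => i _.
  by rewrite -ltnS.
- move=> j /andP[tj jk] Aj; have := ub _ jk Aj.
  by rewrite leqNgt tj.
Qed.

(** The double minimum is at most its starting value [t], so the two subtractions undo each other.
    Bounding it below by [c] bounds each delay index, and [c <= t] comes from the starting value. *)
Lemma freshP (n : nat) (e : rel 'I_n.+1) (K : 'I_n.+1 -> set nat)
    (s : 'I_n.+1 -> 'I_n.+1 -> nat -> nat) (c t : nat) :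
  fresh e K s c t <->
  [/\ forall i, exists2 l, (l <= t)%N & K i l, (c <= t)%N
    & forall i j, j \in cnbr e i -> (c <= s i j (last_update (K i) t))%N].
Proof.
rewrite /fresh /tau; set m := \big[minn/t]_i _.
have mt : (m <= t)%N by have [/(_ (leqnn _))[]] := leq_bigminn xpredT
  (fun i => \big[minn/t]_(j in cnbr e i) s i j (last_update (K i) t)) m t.
rewrite subKn//; split=> [[H /leq_bigminn[ct cs]]|[H ct cs]]; split=> //.
- by move=> i j ij; have /leq_bigminn[_] := cs i isT; exact.
- by apply/leq_bigminn; split=> // i _; apply/leq_bigminn; split=> // j; exact: cs.
Qed.

Lemma nat_minP (A : set nat) (k : nat) : A k -> A (nat_min A).
Proof.
move=> Ak; rewrite /nat_min.
have [] := @xgetPex _ 0%N (A `&` lbound A) => //.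
have ex : exists j, `[< A j >] by exists k; apply/asboolP.
exists (ex_minn ex); case: ex_minnP => j /asboolP Aj lj; split=> // l Al.
by apply: lj; apply/asboolP.
Qed.

Lemma fresh_from_kseqS (n : nat) (e : rel 'I_n.+1) (K : 'I_n.+1 -> set nat)
    (s : 'I_n.+1 -> 'I_n.+1 -> nat -> nat) (B D m t : nat) :
  partially_asynchronous e K s B D ->
  (forall i k, K i k -> s i i k = k) ->
  (kseq e K s m.+1 <= t.+1)%N -> fresh e K s (kseq e K s m) t.
Proof.
move=> [upd del] sii /=; set c := kseq e K s m; rewrite ltnS.
(* Partial asynchrony makes the set non-empty: for [u] at least [c + B + D], each node has updated
   during the last [B] steps, with data at most [D] older, hence dated [c] or later. The successor
   in [kseq] accounts for [t.+1] in the statement. *)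
move=> ct; have := @nat_minP [set k | forall u, (k <= u)%N -> fresh e K s c u]
  (c + B + D)%N; apply=> [u cu|]; last exact: ct.
apply/freshP.
have old i : exists2 l, (u - B <= l <= u)%N & K i l.
  have [l lB Kl] := upd i (u - B)%N; exists l => //; lia.
split; [|lia|].
- by move=> i; have [l /andP[_ lu] Kl] := old i; exists l.
- move=> i j; have [l /andP[ul lu] Kl] := old i.
  have [Kt /andP[lt _] _] := last_updateP lu Kl.
  rewrite in_setU1 => /predU1P[->|ij]; first by rewrite sii//; lia.
  by have /andP[+ _] := del i j _ ij Kt; lia.
Qed.

(** * Error bounds for the asynchronous iteration *)

Lemma async_iterates_hold (R : realType) (n d : nat) (e : rel 'I_n.+1)
    (W : 'M[R]_n.+1) (f : 'I_n.+1 -> 'cV[R]_d -> R) (alpha : R)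
    (K : 'I_n.+1 -> set nat) (s : 'I_n.+1 -> 'I_n.+1 -> nat -> nat)
    (x : nat -> 'cV[R]_(n.+1 * d)) (i : 'I_n.+1) (t k : nat) :
  async_iterates e W f alpha K s x -> (t <= k)%N ->
  (forall j, (t <= j < k)%N -> ~ K i j) -> block (x k) i = block (x t) i.
Proof.
move=> it; elim: k => [|k IH]; first by rewrite leqn0 => /eqP ->.
rewrite leq_eqVlt ltnS => /predU1P[->//|tk] hold.
have [_ ->] := it i k; last by apply: hold; rewrite tk ltnSn.
by apply: IH => // j /andP[tj jk]; apply: hold; rewrite tj ltnW.
Qed.

(** Subtracting the fixed-point equation leaves a convex combination, with weights from row [i] of
    [W], of differences of gradient steps. Each difference is contracted, and the triangle
    inequality keeps the bound. *)
Lemma async_step_contraction (R : realType) (n d : nat) (e : rel 'I_n.+1)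
    (W : 'M[R]_n.+1) (f : 'I_n.+1 -> 'cV[R]_d -> R) (alpha rho c : R)
    (K : 'I_n.+1 -> set nat) (s : 'I_n.+1 -> 'I_n.+1 -> nat -> nat)
    (x : nat -> 'cV[R]_(n.+1 * d)) (xstar : 'cV[R]_(n.+1 * d))
    (i : 'I_n.+1) (t : nat) :
  posdef_averaging e W ->
  (forall j y, differentiable (f j) y) ->
  (forall j u v, enorm ((u - alpha *: grad (f j) u) - (v - alpha *: grad (f j) v))
     <= rho * enorm (u - v)) ->
  0 <= rho ->
  async_iterates e W f alpha K s x -> sync_fixed_point W f alpha xstar ->
  K i t ->
  (forall j, j \in cnbr e i -> enorm (block (x (s i j t) - xstar) j) <= c) ->
  enorm (block (x t.+1 - xstar) i) <= rho * c.
Proof.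
move=> [_ [W0 W1 _] We] df contr rho0 it fx Kt near.
have [/(_ Kt)[_ _ xE] _] := it i t.
have Wout j : j \notin cnbr e i -> W i j = 0.
  rewrite !inE negb_or => /andP[ji eij]; apply: (We i j).2.
  by rewrite negb_or eij eq_sym.
rewrite blockB xE (sync_fixed_point_block i df fx) big_mkcond -sumrB.
(* Both sums now run over all nodes. Outside the closed neighbourhood nothing is known about
   [s i j t], but the weight is zero there, so [g] may be 0. *)
pose g j := if j \in cnbr e i then
  (block (x (s i j t)) j - alpha *: grad (f j) (block (x (s i j t)) j))
   - (block xstar j - alpha *: grad (f j) (block xstar j)) else 0.
rewrite (eq_bigr (fun j => W i j *: g j)) => [|j _]; last first.
  rewrite /g; case: ifPn => ij; first by rewrite -scalerBr.
  by rewrite Wout// !scale0r subrr.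
apply: (le_trans (enorm_sum_le _ _)) => //.
rewrite -[leRHS]mul1r -(W1 i) mulr_suml ler_sum// => j _.
have [ij|ij] := boolP (j \in cnbr e i); last by rewrite Wout// !mul0r.
rewrite ler_wpM2l// /g ij (le_trans (contr _ _ _))// ler_wpM2l//.
by rewrite -blockB near.
Qed.

Theorem theorem7 (R : realType) (n d : nat)
  (e : rel 'I_n.+1) (W : 'M[R]_n.+1)
  (f : 'I_n.+1 -> 'cV[R]_d -> R) (L mu : 'I_n.+1 -> R) (alpha : R)
  (K : 'I_n.+1 -> set nat) (s : 'I_n.+1 -> 'I_n.+1 -> nat -> nat) (B D : nat)
  (x : nat -> 'cV[R]_(n.+1 * d)) (xstar : 'cV[R]_(n.+1 * d)) :
  connected_graph e ->
  posdef_averaging e W ->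
  (forall i, convex_function setT (f i)) ->
  (forall i, 0 < L i /\ smooth (L i) (f i)) ->
  (forall i, exists c : R, forall y, c <= f i y) ->
  minimizers (fun y => \sum_i f i y) !=set0 ->
  bounded_set (minimizers (fun y => \sum_i f i y)) ->
  (forall i, 0 < mu i /\ strongly_convex (mu i) (f i)) ->
  partially_asynchronous e K s B D ->
  0 < alpha < 2 / fmax L ->
  async_iterates e W f alpha K s x ->
  sync_fixed_point W f alpha xstar ->
  forall m k : nat, (kseq e K s m <= k)%N ->
    bnorm (x k - xstar) <= rho_hat alpha L mu ^+ m * bnorm (x 0%N - xstar).
Proof.
move=> _ hW _ hL _ _ _ hmu hpa /andP[a0 aL] it fx.
have df j y : differentiable (f j) y by have [_ []] := hL j.
have Lmax : 0 < fmax L.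
  by have [L0 _] := hL ord0; exact: (lt_le_trans L0 (fmax_ge L ord0)).
have aLi i : alpha * L i < 2.
  apply: (@le_lt_trans _ _ (alpha * fmax L)); last by rewrite -ltr_pdivlMr.
  by rewrite ler_pM2l// fmax_ge.
set rho := rho_hat alpha L mu.
have rho0 : 0 <= rho by exact: sqrtr_ge0.
have rho1 : rho <= 1.
  rewrite -sqrtr1 ler_wsqrtr// lerBlDr lerDl mulr_ge0 ?(ltW a0)//.
  apply: fmin_ge => i; have [mu0 _] := hmu i.
  by rewrite mulr_ge0 ?(ltW mu0)// subr_ge0 ltW.
have contr j u v : enorm ((u - alpha *: grad (f j) u) - (v - alpha *: grad (f j) v))
    <= rho * enorm (u - v).
  have [L0 sm] := hL j; have [mu0 sc] := hmu j.
  apply: (gradient_step_contraction v u L0 sm (ltW mu0) sc (ltW a0) (ltW (aLi j))).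
  exact: fmin_le (fun i => mu i * (2 - alpha * L i)) j.
have step := async_step_contraction hW df contr rho0 it fx.
set M := bnorm (x 0%N - xstar).
have M0 : 0 <= M by rewrite (le_trans (enorm_ge0 _) (enorm_block_le _ ord0)).
have delay_le i j t : K i t -> j \in cnbr e i -> (s i j t <= t)%N.
  move=> Kt; have [/(_ Kt)[sle sii _] _] := it i t.
  by rewrite !inE => /predU1P[->|ij]; [rewrite sii|apply: sle; rewrite inE].
(* The case m = 0 concerns every [k], since k^0 = 0. Strong induction with [rho <= 1] shows that the
   error never exceeds its initial value: a block either still has its initial value or comes from
   an update using earlier iterates. *)
have base k : bnorm (x k - xstar) <= M.
  elim/ltn_ind: k => k IH; apply: fmax_le => i.
  have [[l lk Kl]|no] := pselect (exists2 l, (l < k)%N & K i l); last first.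
    rewrite blockB (async_iterates_hold it (leq0n k)).
      by rewrite -blockB enorm_block_le.
    by move=> j /andP[_ jk] Kj; apply: no; exists j.
  case: k lk IH => // k; rewrite ltnS => lk IH.
  have [Kt /andP[lt tk] after] := last_updateP lk Kl.
  set t := last_update _ _ in Kt lt tk after.
  rewrite blockB (async_iterates_hold (t := t.+1) it)// -blockB.
  apply: (@le_trans _ _ (rho * M)); last by rewrite ler_piMl.
  apply: step => // j ij; rewrite (le_trans (enorm_block_le _ j))// IH//.
  by rewrite ltnS (leq_trans (delay_le _ _ _ Kt ij)).
elim=> [|m IH] k; first by rewrite expr0 mul1r base.
(* k^(m+1) is a successor, so time 0 is excluded; the state at [k.+1] is governed by freshness at
   [k]. *)
case: k => // k mk.
have sii i t : K i t -> s i i t = t.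
  by move=> Kt; have [/(_ Kt)[_ -> _] _] := it i t.
have /freshP[upd ck fr] := fresh_from_kseqS hpa sii mk.
apply: fmax_le => i; have [l lk Kl] := upd i.
have [Kt /andP[lt tk] after] := last_updateP lk Kl.
(* Block [i] has been constant since its last update, all of whose inputs are dated at least k^m, so
   the induction hypothesis applies to each of them. *)
rewrite blockB (async_iterates_hold (t := (last_update (K i) k).+1) it)// -blockB.
rewrite exprS -mulrA; apply: step => // j ij.
by rewrite (le_trans (enorm_block_le _ j))// IH// fr.
Qed.
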